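(* Every nonnegative integer that is not congruent to $3$ modulo $4$ is a fertility number. Moreover, the lower asymptotic density of the set of fertility numbers is at least $\frac{1954}{2565}$ (which is approximately $0.7618$).
   Context: A permutation is a permutation of a finite set of positive integers, written as a word in one-line notation (a word with distinct entries). $S_n$ denotes the set of permutations of $\{1,\ldots,n\}$. West's stack-sorting map $s$ is defined recursively: $s$ sends the empty permutation to the empty permutation, and if $\pi$ is a nonempty permutation with largest entry $m$, write $\pi=LmR$, where $L$ and $R$ are the (possibly empty) substrings of $\pi$ to the left and right of $m$; then $s(\pi)=s(L)s(R)m$. The fertility of a permutation $\pi$ is $|s^{-1}(\pi)|$, the number of preimages of $\pi$ under $s$. A nonnegative integer $f$ is a fertility number if there exists a permutation with fertility $f$. The lower asymptotic density of a set $S$ of nonnegative integers is $\liminf_{N\to\infty}\frac{|S\cap\{0,1,\ldots,N-1\}|}{N}$. *)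

(* Defs.v *)
From HB Require Import structures.
From mathcomp Require Import all_boot all_order all_algebra finmap.
From mathcomp Require Import all_classical all_reals all_analysis.

Set Implicit Arguments.
Unset Strict Implicit.
Unset Printing Implicit Defensive.

Import Order.TTheory GRing.Theory Num.Theory.

Local Open Scope classical_set_scope.

Definition is_permutation (w : seq nat) : bool :=
  uniq w && all (fun x => 0 < x) w.

(* [n] is fuel, sufficient as soon as [size w <= n]; the defining recursion
   s(LmR) = s(L)s(R)m is [stack_sortE] below. *)
Fixpoint stack_sort_rec (n : nat) (w : seq nat) : seq nat :=
  if n isn't n'.+1 then [::] else
  if w is [::] then [::] else
  let m := \max_(x <- w) x in
  let i := index m w in
  stack_sort_rec n' (take i w) ++ stack_sort_rec n' (drop i.+1 w) ++ [:: m].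

Definition stack_sort (w : seq nat) : seq nat := stack_sort_rec (size w) w.

Definition preimages (w : seq nat) : set (seq nat) :=
  [set t | is_permutation t /\ stack_sort t = w].

(* [fset_set] is meaningful on finite sets only; see [finite_preimages]. *)
Definition fertility (w : seq nat) : nat := #|` fset_set (preimages w)|.

Definition fertility_numbers : set nat :=
  [set f | exists w, is_permutation w /\ fertility w = f].

(* The term at N = 0 is 0 / 0 = 0, which does not affect the limit inferior. *)
Definition lower_density (R : realType) (S : set nat) : \bar R :=
  limn_einf (fun N : nat =>
    ((#|` fset_set (S `&` `I_N)|%:R / N%:R : R)%R)%:E).

Lemma max_mem (w : seq nat) : w != [::] -> \max_(x <- w) x \in w.
Proof.
elim: w => // a w IH _; rewrite big_cons inE.
case: (eqVneq w [::]) => [->|/IH wm]; first by rewrite big_nil maxn0 eqxx.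
rewrite /maxn; case: ifP => _; first by rewrite wm orbT.
by rewrite eqxx.
Qed.

Lemma stack_sort_recS n (w : seq nat) (m := \max_(x <- w) x) (i := index m w) :
  w != [::] -> stack_sort_rec n.+1 w =
  stack_sort_rec n (take i w) ++ stack_sort_rec n (drop i.+1 w) ++ [:: m].
Proof. by rewrite {}/i {}/m; case: w. Qed.

Lemma size_splits n (w : seq nat) (i := index (\max_(x <- w) x) w) :
  w != [::] -> size w <= n.+1 ->
  size (take i w) <= n /\ size (drop i.+1 w) <= n.
Proof.
move=> w0 wn; have iw : i < size w by rewrite index_mem max_mem.
rewrite size_drop size_takel ?(ltnW iw)//; split.
  by rewrite -ltnS (leq_trans iw).
by rewrite leq_subLR addSn (leq_trans wn)// ltnS leq_addl.
Qed.

Lemma stack_sort_rec_fuel n p (w : seq nat) :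
  size w <= n -> size w <= p -> stack_sort_rec n w = stack_sort_rec p w.
Proof.
elim: n p w => [|n IH] p w wn wp.
  by move: wn; rewrite leqn0 => /nilP ->; case: p {wp}.
have [->|w0] := eqVneq w [::]; first by case: p {wp}.
case: p wp => [|p] wp.
  by move: w0; move: wp; rewrite leqn0 => /nilP ->.
have [tn dn] := size_splits w0 wn; have [tp dp] := size_splits w0 wp.
by rewrite !stack_sort_recS// (IH p)// (IH p (drop _ _)).
Qed.

Lemma stack_sortE (L R : seq nat) (m : nat) :
  all (fun x => x < m) (L ++ R) ->
  stack_sort (L ++ m :: R) = stack_sort L ++ stack_sort R ++ [:: m].
Proof.
move=> lt_m; have max_m : \max_(x <- L ++ m :: R) x = m.
  apply/eqP; rewrite eqn_leq; apply/andP; split.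
    apply/bigmax_leqP_seq => x; rewrite mem_cat inE => xw _.
    have [->//|xm] := eqVneq x m.
    move: xw; rewrite (negbTE xm) /= -mem_cat => /(allP lt_m).
    exact: ltnW.
  by apply: (@leq_bigmax_seq _ _ _ id) => //; rewrite mem_cat inE eqxx orbT.
have mL : m \notin L.
  apply/negP => mL; have := allP lt_m m.
  by rewrite mem_cat mL ltnn => /(_ isT).
have idx : index m (L ++ m :: R) = size L.
  by rewrite index_cat (negbTE mL) /= eqxx addn0.
rewrite /stack_sort [size (L ++ _)]size_cat /= addnS stack_sort_recS; last first.
  by case: (L).
rewrite max_m idx take_size_cat// -(cat_rcons m L R) drop_size_cat ?size_rcons//.
by congr (_ ++ (_ ++ _)); apply: stack_sort_rec_fuel;
  rewrite ?leq_addl ?leq_addr.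
Qed.

Lemma stack_sort_perm (w : seq nat) : perm_eq (stack_sort w) w.
Proof.
rewrite /stack_sort; move: (leqnn (size w)); move: {2 3}(size w) => n.
elim: n w => [|n IH] w wn; first by move: wn; rewrite leqn0 => /nilP ->.
have [->//|w0] := eqVneq w [::]; have [tn dn] := size_splits w0 wn.
rewrite stack_sort_recS// catA perm_catC /=.
set m := \max_(x <- w) x; set i := index m w.
have iw : i < size w by rewrite index_mem max_mem.
have mE : nth 0 w i = m by rewrite nth_index ?max_mem.
rewrite -[X in perm_eq _ X](cat_take_drop i) (drop_nth 0 iw) mE.
rewrite perm_sym perm_catC /= perm_cons perm_catC perm_sym.
by apply: perm_cat; apply: IH.
Qed.

Lemma finite_preimages (w : seq nat) : finite_set (preimages w).
Proof.
apply: (@sub_finite_set _ _ [set` permutations w]); last exact: finite_seq.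
move=> t [_ <-] /=; rewrite mem_permutations perm_sym.
exact: stack_sort_perm.
Qed.

(* Main.v *)
Require Import Defs.
From mathcomp Require Import all_boot all_order all_algebra finmap.
From mathcomp Require Import all_classical all_reals all_analysis.
From mathcomp Require Import zify.

(** If s(t) is nonempty then its last entry m is the maximum of t, and
    t = L m R with s(L) s(R) m = s(t).  Hence, for m larger than every entry of
    u, a preimage of um is a cut u = u1 u2 together with a preimage of u1 and a
    preimage of u2, so that the fertility F satisfies
    [F(um) = sum over the cuts u = u1 u2 of F(u1) F(u2)]
    ([fertility_rcons]), while F vanishes on a nonempty word that does not end
    in its maximum ([fertility_rcons0]).  In the words used below, most
    cuts contribute nothing by the second fact, as one side of the cut contains an
    entry larger than its last one.

    Products.  If the last entry of p exceeds every entry of the nonempty word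
    q, and m exceeds all entries of both, then the only cut of pq that survives
    is p | q, and so F(pqm) = F(p) F(q).  Fertility is unchanged by a shift of
    the entries, so any two nonempty permutations can be put in this relative
    position: fertility numbers are closed under multiplication
    ([fertility_numbersM]).

    Arithmetic progressions.  Let v be nonempty with v < d < z < m.  Then
    F(dvz) = F(v) and F(dvzm) = F(vz) + 2 F(v).  So passing from v to dvz keeps
    F(v) and adds 2 F(v) to the fertility of v followed by a new maximum.
    Iterating from v = 1, where F(1) = 1 and F(12) = 2, gives the positive even
    numbers; iterating from v = 12, where F(12) = 2 and F(123) = 5, gives the
    numbers 4k + 5.  With F(21) = 0 and F(1) = 1 this is everything that is not
    3 modulo 4.

    Density.  The words 2143567 and 1243567 have fertilities 27 and 95, both
    3 modulo 4.  Multiplying them by the numbers 4k + 1 gives fertility numbers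
    of the form 4j + 3 for all j that are 6 modulo 27 or 23 modulo 95.  There
    are 95 + 27 - 1 = 121 such j among 27 * 95 = 2565 consecutive ones, hence
    at least 3 * 2565 + 121 = 4 * 1954 fertility numbers in every period of
    length 4 * 2565 ([count_fertile_residue], [count_progression_index]), and
    this bounds the lower density ([lower_density_ge]). *)

Set Implicit Arguments.
Unset Strict Implicit.
Unset Printing Implicit Defensive.

Import Order.TTheory GRing.Theory Num.Theory.

Local Open Scope classical_set_scope.
Local Open Scope nat_scope.

(** * Permutations as words *)

Lemma is_permutation_cat (p q : seq nat) :
  is_permutation (p ++ q) -> is_permutation p /\ is_permutation q.
Proof.
rewrite /is_permutation cat_uniq all_cat.
by case/andP=> /and3P[-> _ ->] /andP[-> ->].
Qed.

Lemma is_permutation_perm (p q : seq nat) :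
  perm_eq p q -> is_permutation p = is_permutation q.
Proof. by move=> pq; rewrite /is_permutation (perm_uniq pq) (perm_all _ pq). Qed.

Lemma is_permutation_take (i : nat) (w : seq nat) :
  is_permutation w -> is_permutation (take i w).
Proof. by rewrite -{1}(cat_take_drop i w) => /is_permutation_cat[]. Qed.

Lemma is_permutation_drop (i : nat) (w : seq nat) :
  is_permutation w -> is_permutation (drop i w).
Proof. by rewrite -{1}(cat_take_drop i w) => /is_permutation_cat[]. Qed.

Lemma is_permutation_rcons (u : seq nat) (m : nat) :
  all (fun x => x < m) u -> 0 < m -> is_permutation u ->
  is_permutation (rcons u m).
Proof.
move=> um m0 /andP[uu u0]; rewrite /is_permutation rcons_uniq all_rcons m0 u0 uu.
by rewrite !andbT; apply/negP => /(allP um); rewrite ltnn.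
Qed.

(** * The recursion for the fertility *)

Lemma mem_fset_preimages (w t : seq nat) :
  (t \in fset_set (preimages w)) = (is_permutation t && (stack_sort t == w)).
Proof.
rewrite in_fset_set; last exact: finite_preimages.
by apply/idP/andP => [|[tp /eqP tw]]; rewrite inE// => -[tp /eqP].
Qed.

(** Inverts the defining recursion of the stack-sorting map: the last entry of
    the image is the maximum of the preimage, and distinctness of the entries
    makes it a strict maximum. *)
Lemma stack_sort_rcons_inv (t u : seq nat) (m : nat) :
  is_permutation t -> stack_sort t = rcons u m ->
  exists L R, [/\ t = L ++ m :: R, all (fun x => x < m) (L ++ R)
                & stack_sort L ++ stack_sort R = u].
Proof.
move=> /andP[tu _] tum; have t0 : t != [::].
  by apply/eqP => t0; move: tum; rewrite t0; case: (u).
have max_t := max_mem t0.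
have le_max x : x \in t -> x <= \max_(y <- t) y.
  by move=> xt; apply: (@leq_bigmax_seq _ _ _ id).
move: max_t le_max; set M := \max_(_ <- _) _ => /path.splitPr Mt.
case: Mt tu tum => L R tu tum le_max.
have LR : all (fun x => x < M) (L ++ R).
  apply/allP => x xLR; rewrite ltn_neqAle le_max ?andbT; last first.
    by move: xLR; rewrite !mem_cat inE => /orP[]->; rewrite ?orbT.
  apply/eqP => xM; move: tu; rewrite -cat_rcons (perm_uniq _ (s2 := M :: L ++ R)).
    by rewrite /= -xM xLR.
  by rewrite -cat_cons perm_cat2r perm_rcons.
move: tum; rewrite stack_sortE// catA cats1 => /rcons_inj[uE mE].
by exists L, R; rewrite -mE.
Qed.

Lemma fertility_nil : fertility [::] = 1.
Proof.
rewrite /fertility (_ : preimages [::] = [set [::]]) ?fset_set1 ?cardfs1//.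
apply/seteqP; split => [t [_ t0]|t ->]; last by split.
by apply/perm_nilP; rewrite -t0 perm_sym stack_sort_perm.
Qed.

Lemma fertility_rcons0 (u : seq nat) (m : nat) :
  ~~ all (fun x => x < m) u -> fertility (rcons u m) = 0.
Proof.
move=> /negP um; rewrite /fertility (_ : preimages _ = set0) ?fset_set0//.
apply/seteqP; split => // t [tp /(stack_sort_rcons_inv tp)[L [R [_ LR uE]]]].
case: um; rewrite -uE; move: LR; rewrite !all_cat.
by rewrite !(perm_all _ (stack_sort_perm _)).
Qed.

Lemma cat_pivot_inj (T : eqType) (m : T) (L L' R R' : seq T) :
  m \notin L -> m \notin L' -> L ++ m :: R = L' ++ m :: R' -> L = L' /\ R = R'.
Proof.
elim: L L' => [|x L IH] [|y L'] //=.
- by move=> _ _ [->].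
- by move=> _ yL [yE _]; move: yL; rewrite yE inE eqxx.
- by move=> xL _ [xE _]; move: xL; rewrite xE inE eqxx.
rewrite !inE !negb_or => /andP[_ mL] /andP[_ mL'] [-> /(IH _ mL mL')[-> ->]].
by split.
Qed.

(** A preimage of [rcons u m] is L m R with s(L) s(R) = u.  The size of L is the
    place where u is cut, so the preimages are listed without repetition
    by a cut of u and a preimage of each side. *)
Lemma fertility_rcons (u : seq nat) (m : nat) :
  is_permutation (rcons u m) -> all (fun x => x < m) u ->
  fertility (rcons u m) =
  \sum_(i < (size u).+1) fertility (take i u) * fertility (drop i u).
Proof.
move=> up um; pose pre w : seq (seq nat) := fset_set (preimages w).
pose pairs i := [seq (L, R) | L <- pre (take i u), R <- pre (drop i u)].
pose s := [seq p.1 ++ m :: p.2 | i <- iota 0 (size u).+1, p <- pairs i].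
have mem_pairs i p : p \in pairs i -> [/\ is_permutation p.1,
    is_permutation p.2, stack_sort p.1 = take i u & stack_sort p.2 = drop i u].
  case/allpairsP => -[L R] /= [].
  rewrite !mem_fset_preimages => /andP[? /eqP ?] /andP[? /eqP ?] -> /=.
  by split.
have size_pairs i p : i \in iota 0 (size u).+1 -> p \in pairs i -> size p.1 = i.
  rewrite mem_iota /= add0n ltnS => iu /mem_pairs[_ _ p1 _].
  by rewrite -(perm_size (stack_sort_perm _)) p1 size_takel.
have -> : fertility (rcons u m) = size s.
  rewrite /fertility -(undup_id (s := s)); last first.
    apply: allpairs_uniq_dep; first exact: iota_uniq.
      move=> i _; apply: allpairs_uniq; try exact: fset_uniq.
      by move=> [? ?] [? ?].
    move=> [i p] [j q] /allpairsPdep[i' [p' [ii pp [-> ->]]]].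
    move=> /allpairsPdep[j' [q' [jj qq [-> ->]]]] /= pq.
    (* m does not occur in u, hence neither in L: L and R can be read off from
       L m R, and the size of L is the position of the cut. *)
    have [p1 q1] : m \notin p'.1 /\ m \notin q'.1.
      have mu : m \notin u by apply/negP => /(allP um); rewrite ltnn.
      split; rewrite -(perm_mem (stack_sort_perm _)).
        have [_ _ -> _] := mem_pairs _ _ pp.
        by apply: contra mu => /mem_take.
      have [_ _ -> _] := mem_pairs _ _ qq.
      by apply: contra mu => /mem_take.
    have [e1 e2] := cat_pivot_inj p1 q1 pq.
    have ij : i' = j' by rewrite -(size_pairs _ _ ii pp) -(size_pairs _ _ jj qq) e1.
    by rewrite ij [p']surjective_pairing e1 e2 -surjective_pairing.
  rewrite -card_fseq; congr (#|` _|); apply/fsetP => t.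
  rewrite mem_fset_preimages in_fset; apply/andP/allpairsPdep.
    move=> [tp /eqP /(stack_sort_rcons_inv tp)[L [R [tE _ uE]]]].
    have szL : size L = size (stack_sort L) by rewrite (perm_size (stack_sort_perm L)).
    exists (size L), (L, R); split => //.
      by rewrite mem_iota add0n ltnS -uE size_cat szL leq_addr.
    apply/allpairsP; exists (L, R); rewrite /= !mem_fset_preimages; split => //.
      move: tp; rewrite tE => /is_permutation_cat[-> _].
      by rewrite -uE szL take_size_cat/=.
    move: tp; rewrite tE -cat_rcons => /is_permutation_cat[_ ->].
    by rewrite -uE szL drop_size_cat/=.
  move=> [i [p [ii pp ->]]]; have [p1 p2 s1 s2] := mem_pairs _ _ pp.
  have pE : perm_eq u (p.1 ++ p.2).
    rewrite -(cat_take_drop i u) -s1 -s2.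
    by apply: perm_cat; apply: stack_sort_perm.
  split.
    rewrite -(is_permutation_perm (p := rcons u m))//.
    by rewrite perm_rcons perm_sym -[m :: p.2]cat1s perm_catCA /= perm_cons perm_sym.
  rewrite stack_sortE -?(perm_all _ pE)//.
  by rewrite s1 s2 catA cat_take_drop cats1.
rewrite /s size_allpairs_dep sumnE big_map.
rewrite -(big_mkord xpredT (fun i => fertility (take i u) * fertility (drop i u))).
by rewrite /index_iota subn0; apply: eq_bigr => i _; rewrite size_allpairs.
Qed.

(** The form in which cuts are discarded: every entry of q, in particular the
    last one, is smaller than some earlier entry. *)
Lemma fertility_below (p q : seq nat) (x : nat) :
  x \in p -> q != [::] -> all (fun y => y < x) q -> fertility (p ++ q) = 0.
Proof.
move=> xp; case/lastP: q => // q y _; rewrite all_rcons => /andP[yx _].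
rewrite -rcons_cat fertility_rcons0//; apply/negP => /allP /(_ x).
by rewrite mem_cat xp => /(_ isT); rewrite ltnNge (ltnW yx).
Qed.

(** The recursion made executable, with the fuel [n] bounding the length of the
    word; it computes single fertilities, and it depends only on the relative
    order of the entries. *)
Fixpoint split_count (n : nat) (w : seq nat) : nat :=
  if w isn't x :: s then 1 else
  if n isn't n'.+1 then 0 else
  let u := belast x s in
  if all (fun y => y < last x s) u then
    sumn [seq split_count n' (take i u) * split_count n' (drop i u)
         | i <- iota 0 (size u).+1]
  else 0.

Lemma split_countS (n : nat) (x : nat) (s : seq nat) (u := belast x s) :
  split_count n.+1 (x :: s) =
  if all (fun y => y < last x s) u then
    \sum_(i < (size u).+1) split_count n (take i u) * split_count n (drop i u)
  else 0.
Proof.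
rewrite -(big_mkord xpredT (fun i => split_count n (take i u) *
                                     split_count n (drop i u))).
by rewrite /index_iota subn0 -(big_map _ xpredT id) -sumnE.
Qed.

Lemma fertilityE (n : nat) (w : seq nat) :
  size w <= n -> is_permutation w -> fertility w = split_count n w.
Proof.
elim: n w => [|n IH] [|x s] //; try by rewrite fertility_nil.
rewrite [size _]/= ltnS split_countS lastI => sn.
case: ifP => [um up|/negbT]; last by move=> /fertility_rcons0 ->.
have un : size (belast x s) <= n by rewrite size_belast.
rewrite fertility_rcons//.
have [bp _] : is_permutation (belast x s) /\ is_permutation [:: last x s].
  by apply: is_permutation_cat; rewrite cats1.
apply: eq_bigr => i _; rewrite -!IH ?is_permutation_take ?is_permutation_drop//.
  by rewrite size_drop (leq_trans (leq_subr _ _)).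
by rewrite size_take_min geq_min un orbT.
Qed.

Lemma split_count_shift (n c : nat) (w : seq nat) :
  split_count n (map (addn c) w) = split_count n w.
Proof.
elim: n w => [|n IH] [|x s] //; rewrite [map _ _]/= !split_countS.
rewrite belast_map last_map all_map (eq_all (a2 := fun y => y < last x s)).
  case: ifP => // _; rewrite size_map.
  by apply: eq_bigr => i _; rewrite -map_take -map_drop !IH.
by move=> y /=; rewrite ltn_add2l.
Qed.

Lemma fertility_shift (c : nat) (w : seq nat) :
  is_permutation w -> is_permutation (map (addn c) w) /\
  fertility (map (addn c) w) = fertility w.
Proof.
move=> wp; have cwp : is_permutation (map (addn c) w).
  move: wp => /andP[wu w0].
  rewrite /is_permutation (map_inj_uniq (@addnI c)) wu /=.
  by rewrite all_map; apply: sub_all w0 => x /=; rewrite addn_gt0 orbC => ->.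
by split=> //; rewrite !(fertilityE (n := size w)) ?size_map ?split_count_shift.
Qed.

(** * Products of fertility numbers *)

(** A cut inside p leaves x on its right side, before entries of q; a cut inside
    q leaves x on its left side, before entries of q.  As x exceeds all of q,
    only the cut between p and q contributes. *)
Lemma fertility_rcons_cat (p q : seq nat) (x m : nat) :
  is_permutation (rcons (p ++ q) m) -> all (fun y => y < m) (p ++ q) ->
  x \in p -> last 0 p = x -> q != [::] -> all (fun y => y < x) q ->
  fertility (rcons (p ++ q) m) = fertility p * fertility q.
Proof.
move=> pqm m_max xp lastp q0 qx; rewrite fertility_rcons//.
have szq : 0 < size q by case: (q) q0.
have pq : size p < (size (p ++ q)).+1 by rewrite ltnS size_cat leq_addr.
rewrite (bigD1 (Ordinal pq)) //= take_size_cat// drop_size_cat// big1 ?addn0//.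
move=> i; rewrite -val_eqE /= neq_ltn => /orP[ip|pi].
  rewrite drop_cat ip (@fertility_below _ _ x) ?muln0//.
  rewrite -(cat_take_drop i p) last_cat in lastp.
  case E: (drop i p) lastp => [|z t] /=.
    by move/(congr1 size): E; rewrite size_drop /=; lia.
  by move=> <-; rewrite mem_last.
rewrite take_cat ltnNge (ltnW pi) /= (@fertility_below _ _ x) //.
  by rewrite -size_eq0 size_take_min -lt0n leq_min subn_gt0 pi szq.
by apply/allP => y /mem_take; apply: (allP qx).
Qed.

Lemma le_sumn (w : seq nat) (x : nat) : x \in w -> x <= sumn w.
Proof.
elim: w => //= y w IH; rewrite inE => /orP[/eqP->|/IH xw]; first exact: leq_addr.
exact: leq_trans xw (leq_addl _ _).
Qed.

(** The first word is shifted above the second one and a new maximum is put at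
    the end.  The empty word has to be set aside, since it has no last entry,
    and it has fertility 1. *)
Lemma fertility_numbersM (a b : nat) :
  fertility_numbers a -> fertility_numbers b -> fertility_numbers (a * b).
Proof.
move=> [p [pp pa]] [q [qp qb]].
(* 21 is not the image of any permutation. *)
have [->|a0] := eqVneq (a * b) 0.
  by exists [:: 2; 1]; split=> //; rewrite (fertilityE (n := 2)).
have [p0|p0] := eqVneq p [::].
  by exists q; split => //; rewrite -pa p0 fertility_nil mul1n.
have [q0|q0] := eqVneq q [::].
  by exists p; split => //; rewrite -qb q0 fertility_nil muln1.
(* The sum of the entries serves as an upper bound for each of them. *)
pose c := sumn q; have [] := fertility_shift c pp; set p' := map _ _ => p'p p'a.
have qc y : y \in q -> y <= c := @le_sumn q y.
have p'c y : y \in p' -> c < y.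
  move=> /mapP[z zp ->]; move: pp => /andP[_ /allP/(_ z zp) z0].
  by rewrite -{1}[c]addn0 ltn_add2l.
have p'q : is_permutation (p' ++ q).
  move: p'p qp; rewrite /is_permutation cat_uniq all_cat.
  move=> /andP[-> ->] /andP[-> ->]; rewrite !andbT.
  by apply/hasPn => y /qc; rewrite leqNgt; apply: contra => /p'c.
pose m := (sumn (p' ++ q)).+1.
have mmax : all (fun y => y < m) (p' ++ q).
  by apply/allP => y yw; rewrite ltnS; apply: le_sumn.
have p'0 : last 0 p' \in p'.
  by rewrite /p'; case: (p) p0 => //= z s _; rewrite mem_last.
exists (rcons (p' ++ q) m); split; first exact: is_permutation_rcons.
rewrite (@fertility_rcons_cat _ _ (last 0 p')) ?p'a ?pa ?qb//.
  exact: is_permutation_rcons.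
by apply/allP => y /qc yc; apply: leq_ltn_trans yc _; apply: p'c.
Qed.

(** * Fertility numbers in arithmetic progression *)

Lemma fertility_rcons_max (v : seq nat) (m m' : nat) :
  is_permutation v -> 0 < m -> 0 < m' ->
  all (fun x => x < m) v -> all (fun x => x < m') v ->
  fertility (rcons v m) = fertility (rcons v m').
Proof.
by move=> vp m0 m'0 vm vm'; rewrite !fertility_rcons// is_permutation_rcons.
Qed.

Lemma fertility_singleton (d : nat) : 0 < d -> fertility [:: d] = 1.
Proof.
by move=> d0; rewrite (fertilityE (n := 1))// /is_permutation /= d0.
Qed.

Lemma all_ltn_trans (v : seq nat) (m n : nat) :
  all (fun x => x < m) v -> m <= n -> all (fun x => x < n) v.
Proof. by move=> vm mn; apply: sub_all vm => x /leq_trans; apply. Qed.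

Lemma is_permutation_cons_rcons (v : seq nat) (d z : nat) :
  is_permutation v -> all (fun x => x < d) v -> 0 < d -> d < z ->
  is_permutation (rcons (d :: v) z).
Proof.
move=> vp vd d0 dz; apply: is_permutation_rcons; first last.
- rewrite -(is_permutation_perm (p := rcons v d)) ?perm_rcons//.
  exact: is_permutation_rcons.
- exact: ltn_trans dz.
- by rewrite /= dz (all_ltn_trans vd)// ltnW.
Qed.

(** The product formula for the one-entry word d and the word v. *)
Lemma fertility_cons_rcons (v : seq nat) (d z : nat) :
  is_permutation v -> v != [::] -> 0 < d -> all (fun x => x < d) v -> d < z ->
  fertility (rcons (d :: v) z) = fertility v.
Proof.
move=> vp v0 d0 vd dz; rewrite -[d :: v]cat1s (@fertility_rcons_cat _ _ d)//.
- by rewrite fertility_singleton// mul1n.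
- exact: is_permutation_cons_rcons.
- by rewrite /= dz (all_ltn_trans vd)// ltnW.
- by rewrite inE.
Qed.

(** The two trivial cuts of dvz contribute F(dvz) = F(v) each, and the cut
    d | vz contributes F(vz).  In every other cut the left side is d followed by
    smaller entries, so that nothing is contributed. *)
Lemma fertility_cons_rcons2 (v : seq nat) (d z m : nat) :
  is_permutation v -> v != [::] -> 0 < d ->
  all (fun x => x < d) v -> d < z -> z < m ->
  fertility (rcons (rcons (d :: v) z) m) =
  fertility (rcons v z) + 2 * fertility v.
Proof.
move=> vp v0 d0 vd dz zm.
have up := is_permutation_cons_rcons vp vd d0 dz.
have uF := fertility_cons_rcons vp v0 d0 vd dz.
have um : all (fun x => x < m) (rcons (d :: v) z).
  rewrite all_rcons zm /= (ltn_trans dz zm) (all_ltn_trans vd)//.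
  exact: ltnW (ltn_trans dz zm).
rewrite fertility_rcons//; last by apply: is_permutation_rcons => //; lia.
rewrite size_rcons /= 2!big_ord_recl big_ord_recr /= big1 => [|j _].
  have -> : 0 + bump 0 (size v) = size (rcons v z) by rewrite size_rcons.
  rewrite take_size drop_size take0 drop0 -rcons_cons uF.
  by rewrite fertility_nil fertility_singleton//; lia.
rewrite -[X in fertility X * _]cat1s (@fertility_below _ _ d) ?inE//.
  by rewrite -size_eq0 size_take_min size_rcons -lt0n leq_min /bump leq0n.
have jv : 0 + bump 0 j <= size v by rewrite /bump leq0n add0n add1n ltn_ord.
rewrite -cats1 takel_cat//.
by apply/allP => x /mem_take; apply: (allP vd).
Qed.

(** Each step replaces v by v' = m v (m+1) and the final entry by m+2.  This
    keeps F(v) and adds 2 F(v) to the fertility of the whole word, so that the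
    same step can be repeated. *)
Lemma fertility_numbers_arith (k : nat) (v : seq nat) (m : nat) :
  is_permutation v -> v != [::] -> 0 < m -> all (fun x => x < m) v ->
  fertility_numbers (fertility (rcons v m) + 2 * k * fertility v).
Proof.
elim: k v m => [|k IH] v m vp v0 m0 vm.
  exists (rcons v m); split; last by rewrite muln0 mul0n addn0.
  exact: is_permutation_rcons.
have := IH (rcons (m :: v) m.+1) m.+2.
rewrite fertility_cons_rcons2// fertility_cons_rcons//.
rewrite (@fertility_rcons_max v _ m)//; last exact: all_ltn_trans vm _.
set a := fertility _; set b := fertility v.
rewrite (_ : a + 2 * b + 2 * k * b = a + 2 * k.+1 * b); last by nia.
apply=> //; first exact: is_permutation_cons_rcons.
by rewrite all_rcons /= ltnSn (all_ltn_trans vm) ?andbT; lia.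
Qed.

Lemma fertility_numbers_seq (n : nat) (w : seq nat) :
  is_permutation w -> size w <= n -> fertility_numbers (split_count n w).
Proof. by move=> wp wn; exists w; split=> //; apply: fertilityE. Qed.

Lemma fertility_numbers_not3 (f : nat) :
  f <> 3 %[mod 4] -> fertility_numbers f.
Proof.
have := divn_eq f 4; have : f %% 4 < 4 by rewrite ltn_mod.
rewrite (modn_small (isT : 3 < 4)); set q := f %/ 4.
have F w : is_permutation w -> fertility w = split_count (size w) w.
  exact: fertilityE.
have even k : fertility_numbers (2 * k).
  (* F(12) = 2 and F(1) = 1: the progression 2, 4, 6, etc. *)
  case: k => [|k]; first exact: (@fertility_numbers_seq 2 [:: 2; 1]).
  have := @fertility_numbers_arith k [:: 1] 2 isT isT isT isT.
  by rewrite /rcons !F// (_ : _ + _ = 2 * k.+1)//= /split_count /=; lia.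
have odd k : fertility_numbers (4 * k + 1).
  (* F(123) = 5 and F(12) = 2: the progression 5, 9, 13, etc. *)
  case: k => [|k]; first exact: (@fertility_numbers_seq 1 [:: 1]).
  have := @fertility_numbers_arith k [:: 1; 2] 3 isT isT isT isT.
  by rewrite /rcons !F// (_ : _ + _ = 4 * k.+1 + 1)//= /split_count /=; lia.
case: (f %% 4) => [|[|[|[|]]]]// _ -> _.
- by rewrite (_ : _ + _ = 2 * (2 * q)); [exact: even|lia].
- by rewrite mulnC; exact: odd.
- by rewrite (_ : _ + _ = 2 * (2 * q + 1)); [exact: even|lia].
Qed.

(** * Fertility numbers congruent to 3 modulo 4 *)

Lemma fertility_numbers27 : fertility_numbers 27.
Proof. exact: (@fertility_numbers_seq 7 [:: 2; 1; 4; 3; 5; 6; 7]). Qed.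

Lemma fertility_numbers95 : fertility_numbers 95.
Proof. exact: (@fertility_numbers_seq 7 [:: 1; 2; 4; 3; 5; 6; 7]). Qed.

(** The j for which 4j + 3 is 27 or 95 times a number that is 1 modulo 4:
    27 (4k + 1) = 4 (27k + 6) + 3 and 95 (4k + 1) = 4 (95k + 23) + 3. *)
Definition progression_index (j : nat) : bool :=
  (j %% 27 == 6) || (j %% 95 == 23).

Definition fertile_residue (f : nat) : bool :=
  (f %% 4 != 3) || progression_index (f %/ 4).

Lemma fertility_numbers_residue (f : nat) :
  fertile_residue f -> fertility_numbers f.
Proof.
have not3 k : fertility_numbers (4 * k + 1).
  by apply: fertility_numbers_not3; lia.
have [f3|f3 _] := eqVneq (f %% 4) 3; last first.
  by apply: fertility_numbers_not3; lia.
rewrite /fertile_residue f3 /= => /orP[]/eqP fj.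
- rewrite (_ : f = 27 * (4 * (f %/ 4 %/ 27) + 1)); last by lia.
  exact: fertility_numbersM fertility_numbers27 _.
- rewrite (_ : f = 95 * (4 * (f %/ 4 %/ 95) + 1)); last by lia.
  exact: fertility_numbersM fertility_numbers95 _.
Qed.

(** Of the four numbers 4j, ..., 4j + 3, the first three always count, and the
    last one counts according to j. *)
Lemma count_fertile_residue (k : nat) :
  count fertile_residue (iota 0 (4 * k)) =
  3 * k + count progression_index (iota 0 k).
Proof.
elim: k => // k IH.
have -> : iota 0 k.+1 = iota 0 k ++ [:: k] by rewrite -addn1 iotaD.
have -> : iota 0 (4 * k.+1) =
    iota 0 (4 * k) ++ [:: 4 * k + 0; 4 * k + 1; 4 * k + 2; 4 * k + 3].
  by rewrite mulnS addnC iotaD add0n /= addn0 addn1 addn2 addn3.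
rewrite !count_cat IH /= /fertile_residue.
have q r : r < 4 -> ((4 * k + r) %/ 4 = k) * ((4 * k + r) %% 4 = r).
  by move=> r4; split; lia.
by rewrite !(q 0) ?(q 1) ?(q 2) ?(q 3)//=; lia.
Qed.

Lemma count_iota_periodic (P : pred nat) (p q : nat) :
  (forall n, P (p + n) = P n) ->
  count P (iota 0 (p * q)) = count P (iota 0 p) * q.
Proof.
move=> Pp; elim: q => [|q IH]; first by rewrite !muln0.
rewrite !mulnS iotaD count_cat -[0 + p]addn0 add0n iotaDl count_map -IH.
by congr (_ + _); apply: eq_count => n /=; rewrite Pp.
Qed.

(** The two conditions on j have periods 27 and 95, which are coprime: a common
    period of length 27 * 95 = 2565 contains 95 + 27 - 1 = 121 solutions, the
    one subtracted being the common solution given by the Chinese remainder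
    theorem. *)
Lemma count_progression_index (q : nat) :
  count progression_index (iota 0 (2565 * q)) = 121 * q.
Proof.
have period : count progression_index (iota 0 2565) = 121 by vm_compute.
rewrite count_iota_periodic => [|n]; first by rewrite period.
rewrite /progression_index -[2565]/(27 * 95) modnMDl.
by rewrite [27 * 95]mulnC modnMDl.
Qed.

(** * Lower density *)

Lemma card_fset_setI_II_ge (S : set nat) (N : nat) (P : pred nat) :
  (forall n, P n -> S n) ->
  count P (iota 0 N) <= #|` fset_set (S `&` `I_N)|.
Proof.
move=> PS; rewrite -size_filter.
rewrite -(undup_id (s := [seq n <- iota 0 N | P n])); last first.
  by rewrite filter_uniq// iota_uniq.
rewrite -card_fseq; apply: fsubset_leq_card; apply/fsubsetP => n.
rewrite in_fset mem_filter mem_iota => /andP[/PS Sn nN].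
by rewrite in_fset_set ?inE//; apply: finite_setIr; apply: finite_II.
Qed.

Section LowerDensity.
Local Open Scope ring_scope.

Lemma le_limn_einf (R : realType) (u v : (\bar R)^nat) :
  (forall n, (u n <= v n)%E) -> (limn_einf u <= limn_einf v)%E.
Proof.
move=> uv; rewrite !limn_einf_lim; apply: lee_lim.
- exact: is_cvg_einfs.
- exact: is_cvg_einfs.
apply: nearW => n; apply: le_ereal_inf_tmp => _ [m nm <-].
by apply: le_trans (uv m); apply: ereal_inf_lbound; exists m.
Qed.

(** Rounding N down to a multiple of p loses less than one period, hence less
    than a/N in the ratio; so the ratio is bounded below by a sequence that
    converges to a/p. *)
Lemma lower_density_ge (R : realType) (S : set nat) (a p : nat) : (0 < p)%N ->
  (forall q, (a * q <= #|` fset_set (S `&` `I_(p * q))|)%N) ->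
  ((a%:R / p%:R : R)%:E <= lower_density R S)%E.
Proof.
move=> p0 aS.
(* The error term 2a / (N + 1) dominates a / N for positive N, and it also
   covers N = 0, where the ratio 0 / 0 is 0 while a / p is at most a. *)
pose v n : R := a%:R / p%:R - 2 * a%:R * n.+1%:R^-1.
have vl : (v n)%:E @[n --> \oo] --> (a%:R / p%:R : R)%:E.
  apply: cvg_EFin; first exact: nearW.
  rewrite -[X in _ --> X]subr0 -[X in _ - X](mulr0 (2 * a%:R)).
  apply: cvgB; first exact: cvg_cst.
  by apply: cvgMr; exact: cvg_harmonic.
rewrite /lower_density -(cvg_limn_einf_sup vl).1; apply: le_limn_einf => N.
rewrite lee_fin /v; have [->|N0] := posnP N.
  rewrite invr0 mulr0 invr1 mulr1 subr_le0.
  by rewrite ler_pdivrMr ?ltr0n// -!natrM ler_nat; nia.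
set c := #|` _|.
have ac : (a * (N %/ p) <= c)%N.
  apply: leq_trans (aS _) _; apply: fsubset_leq_card.
  rewrite -fset_set_sub; try by apply: finite_setIr; apply: finite_II.
  apply: setIS => k /= /leq_trans; apply; rewrite mulnC; exact: leq_trunc_div.
have acp : (a * N <= p * c + p * a)%N.
  rewrite {1}(divn_eq N p); have := ltn_pmod N p0; nia.
have NR : 0 < N%:R :> R by rewrite ltr0n.
have le_c : a%:R / p%:R <= (c + a)%:R / N%:R :> R.
  rewrite ler_pdivrMr ?ltr0n// mulrAC ler_pdivlMr// -!natrM ler_nat.
  by rewrite mulnDl -(mulnC p) -(mulnC p).
have le_a : a%:R / N%:R <= 2 * a%:R / N.+1%:R :> R.
  by rewrite ler_pdivrMr// mulrAC ler_pdivlMr// -!natrM ler_nat; nia.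
rewrite lerBlDr (le_trans le_c)// natrD mulrDl lerD2l.
exact: le_a.
Qed.

End LowerDensity.

Theorem theorem3p3 (R : realType) :
  (forall f : nat, f <> 3 %[mod 4] -> fertility_numbers f) /\
  (((1954%:R / 2565%:R : R)%R)%:E <= lower_density R fertility_numbers)%E.
Proof.
split; first exact: fertility_numbers_not3.
have -> : (1954%:R / 2565%:R = (3 * 2565 + 121)%:R / (4 * 2565)%:R :> R)%R.
  have -> : (3 * 2565 + 121 = 4 * 1954)%N by [].
  by rewrite !natrM -mulf_div divff ?pnatr_eq0 ?mul1r.
apply: lower_density_ge => // q; rewrite mulnDl -mulnA -count_progression_index.
rewrite -count_fertile_residue mulnA.
exact: card_fset_setI_II_ge fertility_numbers_residue.
Qed.
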